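(* Let $m\ge 1$ be an integer and let $W=A_{n-1}$ or $W=B_n$, where $n\ge 1$, and let $r$ be the rank of $W$. Then the numbers $N^m_W(i)$, $i=0,1,\ldots,r$, form an $M$-sequence.
   Context: The rank is $r=n-1$ for $W=A_{n-1}$ and $r=n$ for $W=B_n$. The numbers $N^m_W(i)$, $0\le i\le r$, are the generalized Narayana numbers, given by $$N^m_{A_{n-1}}(i)=\frac{1}{i+1}\binom{n-1}{i}\binom{mn}{i},\qquad N^m_{B_n}(i)=\binom{n}{i}\binom{mn}{i}.$$ A finite sequence $(h_0,h_1,\ldots,h_r)$ of nonnegative integers is an $M$-sequence if there is a nonempty finite set $\Gamma$ of monomials in finitely many variables, closed under taking divisors, such that $h_i$ is the number of monomials of degree $i$ in $\Gamma$ for $0\le i\le r$ (and $\Gamma$ has no monomials of degree greater than $r$). *)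

(* Defs.v *)
From mathcomp Require Import all_boot all_order all_algebra finmap.
From mathcomp.multinomials Require Import mpoly.

Set Implicit Arguments.
Unset Strict Implicit.
Unset Printing Implicit Defensive.

Local Open Scope fset_scope.

(* The index is the rank: [TypeA k] is A_k, so A_{n-1} is [TypeA (n - 1)]. *)
Inductive coxeter_type := TypeA of nat | TypeB of nat.

Definition rank (W : coxeter_type) : nat :=
  match W with TypeA k => k | TypeB n => n end.

(* For A_k = A_{n-1} we have n = k + 1.  The division by i + 1 is exact, see
   [narayanaAE] below. *)
Definition narayana (m : nat) (W : coxeter_type) (i : nat) : nat :=
  match W with
  | TypeA k => ('C(k, i) * 'C(m * k.+1, i)) %/ i.+1
  | TypeB n => 'C(n, i) * 'C(m * n, i)
  end.

Lemma dvdn_narayanaA m k i : i.+1 %| 'C(k, i) * 'C(m * k.+1, i).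
Proof.
set X := (X in _ %| X).
have h1 : i.+1 %| k.+1 * X by rewrite /X mulnA mul_bin_diag -mulnA dvdn_mulr.
have h2 : i.+1 %| (m * k.+1).+1 * X.
  by rewrite /X mulnCA mul_bin_diag mulnCA dvdn_mulr.
have : i.+1 %| (m * k.+1).+1 * X - m * (k.+1 * X).
  by apply: dvdn_sub => //; apply: dvdn_mull.
by rewrite mulnA mulSn addnK.
Qed.

Lemma narayanaAE m n i : 0 < n ->
  ((narayana m (TypeA (n - 1)) i)%:R
     = i.+1%:R^-1 * 'C(n - 1, i)%:R * 'C(m * n, i)%:R :> rat)%R.
Proof.
case: n => // k _; rewrite subn1 /=.
have i0 : (i.+1%:R != 0 :> rat)%R by rewrite Num.Theory.pnatr_eq0.
apply: (GRing.mulfI i0).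
rewrite -GRing.natrM [in LHS]mulnC divnK ?dvdn_narayanaA // GRing.natrM.
by rewrite -[in RHS]GRing.mulrA GRing.mulVKf.
Qed.

(* Monomials in k variables are exponent vectors ['X_{1..k}]; the pointwise
   order [(u <= v)%MM] is divisibility.  [h] stands for (h_0, ..., h_r) with
   r + 1 = size h. *)
Definition M_sequence (h : seq nat) : Prop :=
  exists (k : nat) (Gamma : {fset 'X_{1..k}}),
    [/\ Gamma != fset0,
        forall u v : 'X_{1..k}, v \in Gamma -> (u <= v)%MM -> u \in Gamma,
        forall i, i < size h ->
          nth 0 h i = #|` [fset u in Gamma | mdeg u == i] |
      & forall u : 'X_{1..k}, u \in Gamma -> mdeg u < size h].

(* Main.v *)
Require Import Defs.
From mathcomp Require Import all_boot.
From mathcomp Require Import finmap zify.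
From mathcomp.multinomials Require Import mpoly.

(** The numbers are realised as the face numbers of a simplicial complex: the
    squarefree monomials supported on its faces form the required set, the
    degree of a monomial being the size of its face.

    The complex consists of the finite sets of points of a grid, with rows
    y < K and columns x < N, any two of which are strictly comparable in both
    coordinates, all points being taken from a fixed region P of the grid.
    Any subset of such a chain is a chain.

    For B_n the region is the whole n by mn grid.  A chain of size i is a choice
    of i rows and of i columns, so there are C(n, i) C(mn, i) of them.

    For A_{n-1} the grid is n-1 by mn and the region is m (y + 1) <= x.  A chain
    of i points is the set of turns of one kind of a lattice path that stays on
    one side of a line of slope m, i.e. of an m-Dyck path with i + 1 peaks, and
    these are counted by the Fuss-Narayana numbers.  The count is proved by
    recursion on the number of rows ([card_chains]).  To be inductive it needs
    a formula for all numbers c of columns beyond the line, which is the total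
    number of chains minus a ballot-type correction ([chain_count_ballot]):
      C(k, i) C(c, i) - m C(k+1, i+1) C(c-1, i-1)   for c >= m (k + 1), i >= 1.
    At the boundary c = m (k + 1) this is 1/(i+1) C(k, i) C(c, i)
    ([chain_count_narayanaA]). *)

Set Implicit Arguments.
Unset Strict Implicit.
Unset Printing Implicit Defensive.

(** * Simplicial complexes as sets of squarefree monomials *)

Section SquarefreeMonomials.
Variable T : finType.
Implicit Types A B : {set T}.

Definition sqfree_mnm A : 'X_{1..#|T|} :=
  [multinom (enum_val j \in A : nat) | j < #|T|].

Lemma mdeg_sqfree_mnm A : mdeg (sqfree_mnm A) = #|A|.
Proof.
rewrite mdegE -(sum1_card (mem A)) [RHS]big_mkcond [RHS](reindex (@enum_val T predT)) /=.
  by apply: eq_bigr => j _; rewrite mnmE; case: (_ \in A).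
exact/onW_bij/enum_val_bij.
Qed.

Lemma sqfree_mnm_inj : injective sqfree_mnm.
Proof.
move=> A B eqAB; apply/setP => x.
have := congr1 (fun u : 'X_{1..#|T|} => u (enum_rank x)) eqAB.
by rewrite !mnmE enum_rankK; do 2 case: (x \in _).
Qed.

Lemma sqfree_mnm_dvd A (u : 'X_{1..#|T|}) : (u <= sqfree_mnm A)%MM ->
  exists2 B : {set T}, B \subset A & u = sqfree_mnm B.
Proof.
move=> /mnm_lepP le_uA; exists [set x | u (enum_rank x) != 0].
  apply/subsetP => x; rewrite inE; have := le_uA (enum_rank x).
  by rewrite mnmE enum_rankK; case: (x \in A) => //; rewrite leqn0 => ->.
apply/mnmP => j; rewrite mnmE inE enum_valK.
by have := le_uA j; rewrite mnmE; case: (_ \in A); case: (u j) => [|[]].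
Qed.

(** Divisors of squarefree monomials are squarefree, so being closed under
    divisors amounts to being closed under subsets: the face numbers of a
    simplicial complex form an M-sequence. *)
Lemma M_sequence_simplicial_complex (D : {set {set T}}) (h : nat -> nat) r :
    set0 \in D -> (forall A B, B \in D -> A \subset B -> A \in D) ->
    (forall i, #|[set A in D | #|A| == i]| = h i) ->
    (forall i, r < i -> h i = 0) ->
  M_sequence (mkseq h r.+1).
Proof.
move=> D0 Ddown Dcard hr; exists #|T|, [fset sqfree_mnm A | A in D]%fset; split.
- by apply/fset0Pn; exists (sqfree_mnm set0); rewrite in_imfset.
- move=> u v /imfsetP[/= A AD ->] /sqfree_mnm_dvd[B sBA ->].
  by rewrite in_imfset //=; apply: Ddown sBA.
- move=> i; rewrite size_mkseq => lti; rewrite nth_mkseq // -Dcard.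
  have -> : [fset u in [fset sqfree_mnm A | A in D] | mdeg u == i]%fset
          = [fset sqfree_mnm A | A in [set A in D | #|A| == i]]%fset.
    apply/fsetP => u; rewrite !inE /=; apply/andP/imfsetP => /=.
      case=> /imfsetP[/= A AD ->]; rewrite mdeg_sqfree_mnm => Ai.
      by exists A => //; rewrite inE AD.
    case=> A; rewrite inE => /andP[AD Ai] ->.
    by rewrite mdeg_sqfree_mnm in_imfset.
  by rewrite card_imfset /= -?cardE //; apply: sqfree_mnm_inj.
- move=> u; rewrite size_mkseq => /imfsetP[/= A AD ->]; rewrite mdeg_sqfree_mnm ltnS leqNgt.
  apply/negP => /hr h0; have /eqP := Dcard #|A|.
  by rewrite h0 cards_eq0 => /eqP/setP/(_ A); rewrite !inE AD eqxx.
Qed.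

End SquarefreeMonomials.

(** * Chains in a region of a grid *)

(** The number of chains of size [i] in the rows below [k] and the columns below
    [c] of the region [P], by recursion on the top row: either it carries no
    point of the chain, or exactly one, in a column [x], and then the rest of the
    chain lies below row [k'] and column [x]. *)
Fixpoint chain_count (P : nat -> nat -> bool) k i c : nat :=
  match i, k with
  | 0, _ => 1
  | _.+1, 0 => 0
  | i'.+1, k'.+1 =>
      chain_count P k' i c + \sum_(0 <= x < c | P k' x) chain_count P k' i' x
  end.

Section Chains.
Variables (P : nat -> nat -> bool) (K N : nat).
Implicit Types (p q : 'I_K * 'I_N) (A B : {set 'I_K * 'I_N}).

Definition ltp p q := (p.1 < q.1) && (p.2 < q.2).

Definition is_chain A :=
  [forall p in A, forall q in A, (p != q) ==> ltp p q || ltp q p].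

Definition below k c A := [forall p in A, [&& p.1 < k, p.2 < c & P p.1 p.2]].

Definition chains k c := [set A | is_chain A && below k c A].

Lemma is_chainP A :
  reflect {in A &, forall p q, p != q -> ltp p q || ltp q p} (is_chain A).
Proof.
apply: (iffP forall_inP) => [H p q pA qA | H p pA].
  by move/forall_inP/(_ q qA)/implyP: (H p pA).
by apply/forall_inP => q qA; apply/implyP/H.
Qed.

Lemma chains0 k c : set0 \in chains k c.
Proof.
by rewrite inE; apply/andP; split; [apply/is_chainP => p | apply/forall_inP => p]; rewrite inE.
Qed.

Lemma chainsS k c A B : B \in chains k c -> A \subset B -> A \in chains k c.
Proof.
rewrite !inE => /andP[/is_chainP cB /forall_inP bB] /subsetP sAB.
apply/andP; split; first by apply/is_chainP => p q /sAB pB /sAB qB; apply: cB.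
by apply/forall_inP => p /sAB; apply: bB.
Qed.

(** Removing the point [p] of the top row [k] is a bijection onto the chains of
    the smaller grid that lies strictly below [p]. *)
Lemma card_chains_top k c i p : p.1 = k :> nat ->
  #|[set A in chains k.+1 c | (#|A| == i.+1) && (p \in A)]|
   = if (p.2 < c) && P k p.2 then #|[set A in chains k p.2 | #|A| == i]| else 0.
Proof.
move=> pk; case: ifP => [/andP[p2c Pp] | np]; last first.
  apply/eqP; rewrite cards_eq0; apply/set0Pn => -[A].
  rewrite !inE => /andP[/andP[_ /forall_inP bA] /andP[_ /bA]].
  by rewrite pk np andbF.
have notin A : A \in chains k p.2 -> p \notin A.
  rewrite inE => /andP[_ /forall_inP bA]; apply/negP => /bA.
  by rewrite pk ltnn.
rewrite -[RHS](card_in_imset (f := fun A => p |: A)); last first.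
  move=> A B; rewrite in_set => /andP[/notin pA _].
  rewrite in_set => /andP[/notin pB _] eqAB.
  by rewrite -(setU1K pA) eqAB setU1K.
congr #|pred_of_set _|; apply/setP => A; apply/idP/imsetP; last first.
  case=> B; rewrite in_set => /andP[BD Bi] ->.
  rewrite in_set cardsU1 notin // add1n eqSS Bi setU11 !andbT.
  move: BD; rewrite !inE => /andP[/is_chainP cB /forall_inP bB].
  have Bp q : q \in B -> ltp q p by move/bB=> /and3P[? ? _]; rewrite /ltp pk; apply/andP.
  apply/andP; split.
    apply/is_chainP => q q'; rewrite !inE => /orP[/eqP->|qB] /orP[/eqP->|q'B].
    - by rewrite eqxx.
    - by rewrite (Bp _ q'B) orbT.
    - by rewrite (Bp _ qB).
    - exact: cB.
  apply/forall_inP => q; rewrite !inE => /orP[/eqP->|qB].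
    by rewrite pk ltnSn p2c.
  by have /and3P[qk qp ->] := bB q qB; rewrite (leqW qk) (ltn_trans qp).
rewrite in_set => /and3P[AD Ai pA]; exists (A :\ p); last by rewrite setD1K.
move: Ai; rewrite (cardsD1 p) pA add1n eqSS => Ai; rewrite in_set Ai andbT.
move: AD; rewrite !inE => /andP[/is_chainP cA /forall_inP bA].
apply/andP; split.
  apply/is_chainP => q q' /setD1P[_ qA] /setD1P[_ q'A]; exact: cA.
apply/forall_inP => q /setD1P[qp qA].
have /and3P[qk _ ->] := bA q qA; have := cA q p qA pA qp.
by rewrite /ltp pk andbT [k < _]ltnNge (qk : q.1 <= k) orbF.
Qed.

Lemma card_chains_nil k c : #|[set A in chains k c | #|A| == 0]| = 1.
Proof.
apply/eqP/cards1P; exists set0; apply/setP => A; rewrite in_set in_set1 cards_eq0.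
by case: eqVneq => [->|]; rewrite ?andbF // chains0.
Qed.

(** Two points of the top row are incomparable, so the chains that meet it are
    partitioned by the column in which they do. *)
Lemma card_chains k c i : k <= K -> c <= N ->
  #|[set A in chains k c | #|A| == i]| = chain_count P k i c.
Proof.
elim: k i c => [|k IHk] [|i] c leK leN.
- exact: card_chains_nil.
- apply/eqP; rewrite cards_eq0; apply/set0Pn => -[A].
  rewrite !inE => /andP[/andP[_ /forall_inP bA] Ai].
  have /card_gt0P[p /bA] : 0 < #|A| by rewrite (eqP Ai).
  by rewrite ltn0.
- exact: card_chains_nil.
pose row A := [exists x : 'I_N, (Ordinal leK, x) \in A].
pose D := [set A in chains k.+1 c | #|A| == i.+1].
have -> : #|D| = #|[set A in D | ~~ row A]| + #|[set A in D | row A]|.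
  rewrite addnC -!sum1_card (bigID row) /=.
  by congr (_ + _); apply: eq_bigl => A; rewrite [RHS]in_set.
congr (_ + _).
  rewrite -[RHS]/(chain_count P k i.+1 c) -IHk // ?(ltnW leK) //.
  congr #|pred_of_set _|; apply/setP => A; rewrite !inE andbAC; congr (_ && _).
  apply/andP/andP => [[/andP[-> /forall_inP bA] nrow] | [-> /forall_inP bA]]; split=> //.
  - apply/forall_inP => p pA; have /and3P[pk -> ->] := bA p pA.
    rewrite !andbT ltn_neqAle (pk : p.1 <= k) andbT; apply: contraNneq nrow => pk'.
    apply/existsP; exists p.2; suff <- : p = (Ordinal leK, p.2) by [].
    by case: p pk' {pA pk} => p1 p2 /= pk'; congr (_, _); apply: val_inj.
  - by apply/forall_inP => p /bA /and3P[/leqW -> -> ->].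
  - by apply/existsP => -[x /bA]; rewrite /= ltnn.
transitivity (\sum_(x < N) #|[set A in D | (Ordinal leK, x) \in A]|).
  have -> : [set A in D | row A] = \bigcup_(x < N) [set A in D | (Ordinal leK, x) \in A].
    apply/setP => A; rewrite inE; apply/andP/bigcupP.
      by case=> AD /existsP[x xA]; exists x; rewrite // inE AD.
    by case=> x _; rewrite inE => /andP[-> xA]; split=> //; apply/existsP; exists x.
  rewrite -!sum1_card partition_disjoint_bigcup /=; last first.
    move=> x y neq_xy; rewrite -setI_eq0; apply/set0Pn => -[A].
    rewrite !inE => /andP[/andP[/andP[/andP[/is_chainP cA _] _] xA] /andP[_ yA]].
    by have := cA _ _ xA yA; rewrite xpair_eqE eqxx neq_xy /ltp /= ltnn => /(_ isT).
  by apply: eq_bigr => x _; rewrite sum1_card.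
rewrite (big_nat_widen _ _ N) // big_mkord [RHS]big_mkcond.
apply: eq_bigr => x _.
transitivity (if (x < c) && P k x then #|[set A in chains k x | #|A| == i]| else 0).
  rewrite -(@card_chains_top k c i (Ordinal leK, x)) //.
  by congr #|pred_of_set _|; apply/setP => A; rewrite !in_set andbA.
by rewrite andbC IHk // ltnW.
Qed.

Lemma M_sequence_chain_count h r :
    (forall i, chain_count P K i N = h i) -> (forall i, r < i -> h i = 0) ->
  M_sequence (mkseq h r.+1).
Proof.
move=> count h0; apply: (@M_sequence_simplicial_complex _ (chains K N)) h0.
- exact: chains0.
- exact: chainsS.
- by move=> i; rewrite card_chains.
Qed.

End Chains.

(** * Counting chains in the whole grid *)

Lemma chain_count_grid k i c : chain_count (fun _ _ => true) k i c = 'C(k, i) * 'C(c, i).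
Proof.
elim: k i c => [|k IHk] [|i] c //=; rewrite ?bin0 ?bin0n //.
rewrite IHk binS mulnDl; congr (_ + _).
under eq_bigr do rewrite IHk.
rewrite -big_distrr /=; congr (_ * _).
elim: c => [|c IHc]; first by rewrite big_geq.
by rewrite big_nat_recr //= IHc binS addnC.
Qed.

(** * Counting chains beyond a line *)

(** The binomial coefficient C(c, i - 1), which is 0 for [i = 0]: truncated
    subtraction would make it 1. *)
Definition bin_pred c i := if i is j.+1 then 'C(c, j) else 0.

Lemma bin_predD c i : 'C(c.+1, i) = 'C(c, i) + bin_pred c i.
Proof. by case: i => [|i] /=; rewrite ?bin0 ?binS. Qed.

(** Summation over the column of a new top row turns the formula for chains of
    size [i] into the increment in [k] of the formula for size [i + 1].  In [c],
    both sides grow by the hypothesis on [F] and Pascal's rule; at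
    [m * k.+1 = c.+1] the row is empty, and it is there that the factor [m] of
    the correction term is the right one. *)
Lemma sum_ballot_row m k i c (F : nat -> nat) : 0 < m ->
    (forall x, m * k.+1 <= x.+1 ->
       F x.+1 + m * ('C(k.+1, i.+1) * bin_pred x i) = 'C(k, i) * 'C(x.+1, i)) ->
    m * k.+1 <= c.+1 ->
  \sum_(0 <= x < c.+1 | m * k.+1 <= x) F x + m * ('C(k.+1, i.+1) * 'C(c, i))
    = 'C(k, i) * 'C(c.+1, i.+1).
Proof.
move=> m_gt0 HF.
have base d : m * k.+1 = d.+1 ->
  \sum_(0 <= x < d.+1 | m * k.+1 <= x) F x + m * ('C(k.+1, i.+1) * 'C(d, i))
    = 'C(k, i) * 'C(d.+1, i.+1).
  move=> Dc; rewrite Dc big_nat_cond big1 => [|x]; last by lia.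
  (* The factor i + 1 lets both binomial coefficients absorb. *)
  rewrite add0n; apply/eqP; rewrite -(eqn_pmul2l (ltn0Sn i)); apply/eqP.
  rewrite [RHS]mulnCA -mul_bin_diag /= -Dc.
  have /= Dk := mul_bin_diag k.+1 i.
  transitivity (m * 'C(d, i) * (i.+1 * 'C(k.+1, i.+1))); first by lia.
  by rewrite -Dk; lia.
elim: c => [|c IHc] le_c.
  by apply: base; apply/eqP; rewrite eqn_leq le_c muln_gt0 m_gt0.
move: le_c; rewrite leq_eqVlt => /orP[/eqP/base // | ge_c].
rewrite big_mkcond big_nat_recr //= -big_mkcond -ltnS ge_c.
rewrite [in LHS](bin_predD c i) [in RHS]binS [RHS]mulnDr -(IHc ge_c) -(HF c ge_c).
by rewrite !mulnDr addnACA.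
Qed.

(** Rows are numbered from 0, hence the successor: with rows numbered from 1 this
    is the region beyond the line x = m y. *)
Definition ballot m y x := m * y.+1 <= x.

(** The width is written [c.+1] so that the binomial coefficient C(c - 1, i - 1)
    of the correction term needs no subtraction.  The bound on the width is
    what the induction needs: a point in column [x] of row [k] of the region
    leaves a grid with [k] rows and [x >= m * k.+1] columns. *)
Lemma chain_count_ballot m k i c : 0 < m -> m * k.+1 <= c.+1 ->
  chain_count (ballot m) k i c.+1
    + m * ('C(k.+1, i.+1) * bin_pred c i) = 'C(k, i) * 'C(c.+1, i).
Proof.
move=> m_gt0; elim: k i c => [|k IHk] [|i] c le_c /=; rewrite ?bin0 ?bin0n ?bin1 ?muln0 //.
have le_c' : m * k.+1 <= c.+1 by apply: leq_trans le_c; rewrite leq_mul2l leqnSn orbT.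
have row := sum_ballot_row m_gt0 (fun x => IHk i x) le_c'.
rewrite [in LHS]binS [in RHS]binS [RHS]mulnDl addnC -row -(IHk i.+1 c le_c') /=.
by rewrite addnC mulnDl mulnDr addnACA.
Qed.

(** * The generalized Narayana numbers *)

(** When the width is exactly m (k + 1), absorption identities for both binomial
    coefficients turn the correction term into the fraction i / (i + 1) of
    C(k, i) C(m (k + 1), i). *)
Lemma chain_count_narayanaA m k i : 0 < m ->
  chain_count (ballot m) k i (m * k.+1) = narayana m (TypeA k) i.
Proof.
move=> m_gt0; have [c Dc] : exists c, m * k.+1 = c.+1.
  by exists (m * k.+1).-1; rewrite prednK // muln_gt0 m_gt0.
have := chain_count_ballot i m_gt0 (eq_leq Dc).
rewrite /= Dc; set f := chain_count _ _ _ _ => Hf.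
suff Df : 'C(k, i) * 'C(c.+1, i) = f * i.+1 by rewrite Df mulnK.
case: i f Hf => [|j] f /= Hf; first by rewrite -Hf !muln0 addn0 muln1.
have /= Dk := mul_bin_diag k.+1 j.+1; have /= Dc' := mul_bin_diag c.+1 j.
have : j.+2 * (m * ('C(k.+1, j.+2) * 'C(c, j))) = j.+1 * ('C(k, j.+1) * 'C(c.+1, j.+1)).
  transitivity (m * 'C(c, j) * (j.+2 * 'C(k.+1, j.+2))); first by lia.
  rewrite -Dk; transitivity (m * k.+1 * 'C(c, j) * 'C(k, j.+1)); first by lia.
  by rewrite Dc Dc'; lia.
by rewrite -Hf; lia.
Qed.

Theorem corollary1p6 (m n : nat) (W : coxeter_type) (hm : 1 <= m) (hn : 1 <= n)
    (hW : W = TypeA (n - 1) \/ W = TypeB n) :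
  M_sequence (mkseq (narayana m W) (rank W).+1).
Proof.
case: hW => ->.
  apply: (@M_sequence_chain_count (ballot m) (n - 1) (m * (n - 1).+1)).
    by move=> i; rewrite chain_count_narayanaA.
  by move=> i /= lti; rewrite bin_small // div0n.
apply: (@M_sequence_chain_count (fun _ _ => true) n (m * n)).
  by move=> i; rewrite chain_count_grid.
by move=> i /= lti; rewrite bin_small.
Qed.
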